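(* Let $\mathscr{H}$ be a complex Hilbert space, let $k,n$ be positive integers, and let $T$ be a $k$-quasi $n$-power posinormal bounded linear operator on $\mathscr{H}$. If $T$ commutes with an isometric operator $S$ on $\mathscr{H}$, then $TS$ is a $k$-quasi $n$-power posinormal operator.
   Context: For a bounded operator $X$, $R(X)$ denotes its range and $X^{*k}=(X^* )^k$. A bounded operator $T$ on a Hilbert space is $k$-quasi $n$-power posinormal if $R(T^{*k}T^n)\subseteq R(T^{*(k+1)})$; equivalently, there is $\lambda>0$ with $T^{*k}(\lambda^2T^*T-T^nT^{*n})T^k\ge 0$. *)

(* Defs.v *)
From mathcomp Require Import all_boot all_order all_algebra.
From mathcomp Require Import complex.
From mathcomp Require Import all_classical all_reals all_analysis.

Set Implicit Arguments.
Unset Strict Implicit.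
Unset Printing Implicit Defensive.
Import Order.TTheory GRing.Theory Num.Theory.
Import numFieldNormedType.Exports.
Local Open Scope classical_set_scope.
Local Open Scope ring_scope.
Local Open Scope complex_scope.

(* The inner product is linear in its first argument, and the norm of the
   completeNormedModType is the one it induces; norms have values in R[i]. *)
Definition hilbert_dot (R : realType) (H : completeNormedModType R[i])
    (dot : {dot H for Num.conj}) : Prop :=
  forall x : H, `|x| ^+ 2 = dot x x.

(* See linear_boundedP: equivalent to a bound `|T x| <= M * `|x| for all x. *)
Definition bounded_operator (R : realType) (H : completeNormedModType R[i])
    (T : {linear H -> H}) : Prop :=
  bounded_near T (nbhs (0 : H)).

Definition isometric_operator (R : realType) (H : completeNormedModType R[i])
    (S : {linear H -> H}) : Prop :=
  forall x : H, `|S x| = `|x|.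

(* T^* y is the z with <T x, y> = <x, z> for all x: at most one such z exists
   since dot is definite, and one exists when T is bounded, by the Riesz
   representation theorem; the default value of xget is then irrelevant. *)
Definition adjoint (R : realType) (H : completeNormedModType R[i])
    (dot : {dot H for Num.conj}) (T : H -> H) : H -> H :=
  fun y => xget 0 [set z | forall x : H, dot (T x) y = dot x z].

Definition quasi_power_posinormal (R : realType)
    (H : completeNormedModType R[i]) (dot : {dot H for Num.conj})
    (k n : nat) (T : {linear H -> H}) : Prop :=
  bounded_operator T /\
  range (iter k (adjoint dot T) \o iter n T) `<=`
  range (iter k.+1 (adjoint dot T)).

(* Main.v *)
(* Since S^* S = 1 and T^*, S^* commute, T^{*k} T^n (S^n x) = T^{*(k+1)} y gives
   (TS)^{*k} (TS)^n x = S^{*k} T^{*(k+1)} y = S^{*k} T^{*(k+1)} S^* S y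
                      = (TS)^{*(k+1)} (S y).
   The adjoints exist by the Riesz representation theorem, obtained by
   minimizing a quadratic functional for the real inner product Re <x, y>. *)
Require Import Defs.
From mathcomp Require Import all_boot all_order all_algebra.
From mathcomp Require Import complex.
From mathcomp Require Import all_classical all_reals all_analysis.
From mathcomp Require Import ring lra.
Set Implicit Arguments.
Unset Strict Implicit.
Unset Printing Implicit Defensive.
Import Order.TTheory GRing.Theory Num.Theory.
Import numFieldNormedType.Exports.
Local Open Scope classical_set_scope.
Local Open Scope ring_scope.
Local Open Scope complex_scope.

(** The order of [R[i]] is only partial; real values allow minimization and linear arithmetic. *)
Definition rdot (R : realType) (H : lmodType R[i]) (dot : {dot H for Num.conj})
  (x y : H) : R := complex.Re (dot x y).

(** * The real inner product Re <x, y> *)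

Section RealPart.
Variables (R : realType) (H : lmodType R[i]) (dot : {dot H for Num.conj}).
Local Notation b := (rdot dot).
Local Notation q x := (b x x).

Lemma dotC x y : dot x y = (dot y x)^*.
Proof. by rewrite hermC mul1r. Qed.

Lemma dotDl x x' y : dot (x + x') y = dot x y + dot x' y.
Proof. exact: linearDl. Qed.

Lemma dotZl a x y : dot (a *: x) y = a * dot x y.
Proof. exact: linearZl_LR. Qed.

Lemma rdotC x y : b x y = b y x.
Proof. by rewrite /rdot dotC; case: (dot y x). Qed.

Lemma rdotDl x x' y : b (x + x') y = b x y + b x' y.
Proof. by rewrite /rdot dotDl; case: (dot x y); case: (dot x' y). Qed.

Lemma rdotZl (a : R) x y : b (a%:C *: x) y = a * b x y.
Proof.
by rewrite /rdot dotZl /=; case: (dot x y) => u v /=; rewrite mul0r subr0.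
Qed.

Lemma rdotil x y : b ('i *: x) y = - complex.Im (dot x y).
Proof.
by rewrite /rdot dotZl /=; case: (dot x y) => u v /=; rewrite mul0r mul1r sub0r.
Qed.

Lemma rdotNl x y : b (- x) y = - b x y.
Proof. by rewrite -scaleN1r -(rmorphN1 (real_complex R)) rdotZl mulN1r. Qed.

Lemma rdotBl x x' y : b (x - x') y = b x y - b x' y.
Proof. by rewrite rdotDl rdotNl. Qed.

Lemma rdotDr x y y' : b x (y + y') = b x y + b x y'.
Proof. by rewrite !(rdotC x) rdotDl. Qed.

Lemma rdotZr (a : R) x y : b x (a%:C *: y) = a * b x y.
Proof. by rewrite !(rdotC x) rdotZl. Qed.

Lemma rdotNr x y : b x (- y) = - b x y.
Proof. by rewrite !(rdotC x) rdotNl. Qed.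

Lemma rdotBr x y y' : b x (y - y') = b x y - b x y'.
Proof. by rewrite !(rdotC x) rdotBl. Qed.

Lemma dot_sqrE x : dot x x = (q x)%:C.
Proof.
have := dnorm_ge0 dot x.
by rewrite /rdot; case: (dot x x) => u v; rewrite lecE /= => /andP[/eqP-> _].
Qed.

Lemma rdot_ge0 x : 0 <= q x.
Proof. by rewrite -lecR -dot_sqrE dnorm_ge0. Qed.

Lemma rdot_eq0 x : (q x == 0) = (x == 0).
Proof. by rewrite -(dnorm_eq0 dot) dot_sqrE -(inj_eq (@complexI R)). Qed.

(** For [y != 0], the square of [q y *: x - b x y *: y] expands to [q y * (q x * q y - b x y ^+ 2)],
    and [q y] is positive. *)
Lemma rdot_cauchy_schwarz x y : b x y ^+ 2 <= q x * q y.
Proof.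
have [->|y0] := eqVneq y 0.
  by rewrite -(subrr x) !rdotBr !subrr mulr0 expr0n.
have qy : 0 < q y by rewrite lt_def rdot_eq0 y0 rdot_ge0.
have := rdot_ge0 ((q y)%:C *: x - (b x y)%:C *: y).
rewrite !(rdotBl, rdotBr, rdotZl, rdotZr) (rdotC y x) => h.
rewrite -subr_ge0 -(pmulr_rge0 _ qy); apply: le_trans h _.
by rewrite le_eqVlt; apply/orP; left; apply/eqP; ring.
Qed.

Lemma rdot_polar x y : q (x + y) = q x + q y + 2 * b x y.
Proof. by rewrite !(rdotDl, rdotDr) (rdotC y x); ring. Qed.

(* Re ('i * z) = - Im z, so the real form determines the complex one. *)
Lemma eq_dot_rdot x y x' y' :
  b x y = b x' y' -> b ('i *: x) y = b ('i *: x') y' -> dot x y = dot x' y'.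
Proof.
rewrite !rdotil /rdot; case: (dot x y) => u v; case: (dot x' y') => u' v' /= ->.
by move=> /eqP; rewrite eqr_opp => /eqP->.
Qed.

Lemma rdot_unique z z' : (forall x, b x z = b x z') -> z = z'.
Proof.
move=> h; apply/eqP; rewrite -subr_eq0 -rdot_eq0 rdotBr; apply/eqP.
by rewrite h subrr.
Qed.
End RealPart.

(** * Riesz representation, adjoints and isometries *)

Section Riesz.
Variables (R : realType) (H : completeNormedModType R[i]).
Variable dot : {dot H for Num.conj}.
Hypothesis Hdot : hilbert_dot dot.
Local Notation b := (rdot dot).
Local Notation q x := (b x x).

(** Norms take values in [R[i]]; comparing squares moves estimates to [R]. *)
Lemma normr_ltc (x : H) (e : R) : 0 < e -> (`|x| < e%:C) = (q x < e ^+ 2).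
Proof.
move=> e0; rewrite -(@ltr_pXn2r _ 2)// ?nnegrE ?normr_ge0 ?ler0c ?(ltW e0)//.
by rewrite Hdot dot_sqrE -rmorphXn ltcR.
Qed.

Lemma normr_lec (x y : H) (e : R) :
  0 <= e -> (`|x| <= e%:C * `|y|) = (q x <= e ^+ 2 * q y).
Proof.
move=> e0; rewrite -(@ler_pXn2r _ 2)// ?nnegrE ?mulr_ge0 ?normr_ge0 ?ler0c//.
by rewrite exprMn !Hdot !dot_sqrE -rmorphXn -rmorphM lecR.
Qed.

(* The representing vector minimizes J x = <x, x> - 2 l x: any approximate
   minimizer almost satisfies the first-order condition 2 (<h, x> - l h) +
   <h, h> >= 0, which therefore holds exactly at the limit. *)
Lemma real_riesz (l : H -> R) (M : R) :
  (forall x y, l (x + y) = l x + l y) ->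
  (forall (a : R) x, l (a%:C *: x) = a * l x) ->
  (forall x, l x ^+ 2 <= M * q x) ->
  exists z, forall x, l x = b x z.
Proof.
move=> lD lZ lM0; have [{lM0}M M_gt0 lM] :
    exists2 M, 0 < M & forall x, l x ^+ 2 <= M * q x.
  exists (`|M| + 1) => [|x]; first by rewrite ltr_wpDl.
  apply: le_trans (lM0 x) _; rewrite ler_wpM2r ?rdot_ge0//.
  by apply: le_trans (ler_norm M) _; rewrite lerDl.
pose J x := q x - 2 * l x.
(* Indeed [M * (J x + M)] is at least [(l x - M) ^+ 2]. *)
have J_ge x : - M <= J x.
  rewrite -subr_ge0 -(pmulr_rge0 _ M_gt0) /J.
  have : 0 <= (l x - M) ^+ 2 by apply: sqr_ge0.
  have := lM x; nra.
pose d := inf (range J).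
have infJ : has_inf (range J).
  by split; [exists (J 0), 0 | exists (- M) => _ [x _ <-]].
have dJ x : d <= J x by apply: ge_inf; [case: infJ | exists x].
have near_min (e : R) : 0 < e -> exists x, J x < d + e.
  by move=> e0; have [_ [x _ <-] Jx] := inf_adherent e0 infJ; exists x.
(* By the parallelogram identity, minimizing sequences of J are Cauchy. *)
have J_close x y (e : R) : J x < d + e -> J y < d + e -> q (x - y) < 4 * e.
  move=> Jx Jy; have := dJ ((1 / 2)%:C *: (x + y)).
  move: Jx Jy; rewrite /J !(lZ, lD, rdotZl, rdotZr, rdotDl, rdotDr).
  rewrite !(rdotNl, rdotNr) (rdotC dot y x); lra.
(* The sublevel sets of [J] generate a filter that replaces a minimizing sequence and avoids
   choosing points. *)
pose F := filter_from [set e : R | 0 < e] (fun e => [set x | J x < d + e]).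
have FF : ProperFilter F.
  apply: filter_from_proper => [|e e0]; last exact: near_min.
  apply: filter_from_filter => [|e e' /= e0 e'0]; first by exists 1 => /=.
  exists (Num.min e e') => /=; first by rewrite lt_min e0.
  by move=> x /= Jx; split; apply: lt_le_trans Jx _; rewrite lerD2l ge_min lexx ?orbT.
have Fc : cauchy F.
  apply: cauchy_exP => -[e e'] /=; rewrite ltcE /= => /andP[/eqP-> e0].
  (* With this gap [J_close] yields [q (x - y) < e ^+ 2]. *)
  have e24 : 0 < e ^+ 2 / 4 by rewrite divr_gt0 ?exprn_gt0.
  have [x Jx] := near_min _ e24; exists x, (e ^+ 2 / 4) => //= y /= Jy.
  rewrite -ball_normE /= normr_ltc//; apply: lt_le_trans (J_close _ _ _ Jx Jy) _.
  by rewrite mulrC divfK.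
have Fz : F --> lim F by apply: cauchy_cvg.
set z := lim F in Fz.
have min_seq (e : R) : 0 < e -> exists x, J x < d + e /\ q (z - x) < e ^+ 2.
  move=> e0; have [e1 /= e10 sub1] : F (ball z e%:C).
    by apply: Fz; apply: nbhsx_ballx; rewrite ltcR.
  (* A gap below [e] controls [J x]; a gap below [e1] puts [x] in the ball around [z]. *)
  have m0 : 0 < Num.min e e1 by rewrite lt_min e0.
  have [x Jx] := near_min _ m0; exists x; split.
    by apply: lt_le_trans Jx _; rewrite lerD2l ge_min lexx.
  rewrite -normr_ltc//; have := sub1 x; rewrite -ball_normE; apply => /=.
  by apply: lt_le_trans Jx _; rewrite lerD2l ge_min lexx orbT.
have var1 h : 0 <= q h + 2 * (b h z - l h).
  rewrite leNgt; apply/negP => neg.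
  set v := q h + _ in neg.
  (* From [d <= J (x + h)] and [J x < d + e], passing from [x] to [z] loses [e] plus
     [2 * (1 + q h) * e], which is [K * e]; the choice of [e] makes this loss exactly [- v]. *)
  pose K := 3 + 2 * q h; have qh := rdot_ge0 dot h.
  have K0 : 0 < K by rewrite /K; lra.
  pose e := - v / K; have e0 : 0 < e by rewrite divr_gt0 ?oppr_gt0.
  have vE : v = - (e * K) by rewrite /e divfK ?gt_eqF ?opprK.
  have [x [Jx qzx]] := min_seq _ e0.
  (* Cauchy-Schwarz without square roots, using [q h <= (1 + q h) ^+ 2]. *)
  have cs : - b h (z - x) <= (1 + q h) * e.
    have ge0 : 0 <= (1 + q h) * e by rewrite mulr_ge0 ?ltW// ltr_wpDr.
    apply: le_trans (ler_norm _) _; rewrite ?normrN.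
    rewrite -(@ler_pXn2r _ 2)// ?nnegrE ?normr_ge0// real_normK ?num_real//.
    apply: le_trans (rdot_cauchy_schwarz dot h (z - x)) _.
    rewrite exprMn; apply: ler_pM; rewrite ?rdot_ge0 ?(ltW qzx)//.
    by have := sqr_ge0 (q h); move: qh; rewrite sqrrD expr1n mul1r; lra.
  have := dJ (x + h); move: Jx vE cs.
  rewrite /J /v /K !(lD, rdotDl, rdotDr, rdotNl, rdotNr) (rdotC dot h x).
  lra.
have var2 h : l h <= b h z.
  rewrite leNgt; apply/negP => neg.
  (* At [t *: h], the right side of [var1] becomes [- t ^+ 2 * (2 + q h)], which is negative. *)
  pose t := (l h - b h z) / (1 + q h); have qh := rdot_ge0 dot h.
  have q1 : 0 < 1 + q h by rewrite ltr_wpDr.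
  have t0 : 0 < t by rewrite divr_gt0 ?subr_gt0.
  have tE : b h z - l h = - (t * (1 + q h)) by rewrite /t divfK ?gt_eqF ?opprB.
  have := var1 (t%:C *: h); rewrite lZ !(rdotZl, rdotZr).
  have := mulr_gt0 (mulr_gt0 t0 t0) q1; have := mulr_gt0 t0 t0.
  rewrite -mulrBr tE; lra.
exists z => x; apply/eqP; rewrite eq_le var2 /=.
(* Replacing [x] by [- x] reverses the inequality. *)
have := var2 ((-1)%:C *: x); rewrite lZ rdotZl; lra.
Qed.

Lemma bounded_operatorP (T : {linear H -> H}) :
  bounded_operator T <-> exists M : R, forall x, q (T x) <= M * q x.
Proof.
split=> [/linear_boundedP/pinfty_ex_gt0[[r r'] /=]|[M TM]].
  rewrite ltcE /= => /andP[/eqP-> r0] Tr; exists (r ^+ 2) => x.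
  by rewrite -normr_lec ?(ltW r0).
(* This constant avoids a square root, since [M <= (1 + |M|) ^+ 2]. *)
apply/linear_boundedP; exists (1 + `|M|)%:C; split.
  by rewrite ger0_real// ler0c addr_ge0.
move=> r Mr x; apply: (@le_trans _ _ ((1 + `|M|)%:C * `|x|)); last first.
  by rewrite ler_wpM2r// ltW.
rewrite normr_lec ?addr_ge0//; apply: le_trans (TM x) _.
rewrite ler_wpM2r ?rdot_ge0//; apply: le_trans (ler_norm M) _.
have := normr_ge0 M; have := sqr_ge0 `|M|; rewrite sqrrD expr1n mul1r; lra.
Qed.

(** [real_riesz] represents the real part of <T x, y>; complex linearity of [T] (replace [x] by
    ['i *: x]) recovers the imaginary part, so [xget] never falls back on its default. *)
Lemma adjointE (T : {linear H -> H}) : bounded_operator T ->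
  forall x y, dot (T x) y = dot x (adjoint dot T y).
Proof.
move=> /bounded_operatorP[M TM] x y; move: x; rewrite /adjoint.
case: xgetP => // noadj.
have [x y'|a x|x|z lz] := @real_riesz (fun x => b (T x) y) (M * q y).
- by rewrite linearD rdotDl.
- by rewrite linearZ rdotZl.
- apply: le_trans (rdot_cauchy_schwarz dot _ _) _.
  by rewrite mulrAC ler_wpM2r ?rdot_ge0.
exfalso; apply: (noadj z) => x /=; apply: eq_dot_rdot => //.
by rewrite -lz linearZ.
Qed.

(** The witness [z] itself keeps [xget] off its default, and definiteness identifies the chosen
    value with [z]. *)
Lemma adjoint_unique (T : H -> H) y z :
  (forall x, dot (T x) y = dot x z) -> adjoint dot T y = z.
Proof.
move=> Tyz; apply: (@rdot_unique _ _ dot) => x; rewrite /rdot.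
by rewrite /adjoint; case: xgetP => [u _ /= <-|/(_ z)//]; rewrite Tyz.
Qed.

Lemma adjoint_comp (T S : {linear H -> H}) :
  bounded_operator T -> bounded_operator S ->
  adjoint dot (T \o S) =1 adjoint dot S \o adjoint dot T.
Proof.
by move=> bT bS y; apply: adjoint_unique => x /=; rewrite !adjointE.
Qed.

(** Polarization gives the real part; the imaginary part follows at ['i *: x]. *)
Lemma isometric_dot (S : {linear H -> H}) : isometric_operator S ->
  forall x y, dot (S x) (S y) = dot x y.
Proof.
move=> isoS; have qS x : q (S x) = q x by rewrite /rdot -!Hdot isoS.
have bS x y : b (S x) (S y) = b x y.
  have := qS (x + y); rewrite linearD !rdot_polar !qS; lra.
by move=> x y; apply: eq_dot_rdot; rewrite -?linearZ ?bS.
Qed.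

Lemma isometric_bounded (S : {linear H -> H}) :
  isometric_operator S -> bounded_operator S.
Proof.
move=> isoS; apply/bounded_operatorP; exists 1 => x.
by rewrite /rdot isometric_dot ?mul1r.
Qed.

Lemma adjoint_isometric (S : {linear H -> H}) :
  isometric_operator S -> cancel S (adjoint dot S).
Proof. by move=> isoS y; apply: adjoint_unique => x; exact: isometric_dot. Qed.

Lemma bounded_comp (T S : {linear H -> H}) :
  bounded_operator T -> bounded_operator S -> bounded_operator (T \o S).
Proof.
move=> /bounded_operatorP[M TM] /bounded_operatorP[N SN].
apply/bounded_operatorP; exists (`|M| * N) => x /=.
apply: le_trans (TM _) _; rewrite -mulrA.
apply: (@le_trans _ _ (`|M| * q (S x))).
  by rewrite ler_wpM2r ?rdot_ge0 ?ler_norm.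
by rewrite ler_wpM2l.
Qed.
End Riesz.

(** * Iterates of commuting maps *)

Lemma iter_commute (A : Type) (f g : A -> A) (n : nat) :
  f \o g =1 g \o f -> iter n f \o g =1 g \o iter n f.
Proof. by move=> fg x /=; elim: n => //= n ->; exact: fg. Qed.

Lemma iter_comp_commute (A : Type) (f g : A -> A) (n : nat) :
  f \o g =1 g \o f -> iter n (f \o g) =1 iter n f \o iter n g.
Proof.
move=> fg x; elim: n => //= n ->; congr f.
by rewrite -[g _]/((g \o iter n f) _) -iter_commute.
Qed.

Unset Implicit Arguments.
Set Strict Implicit.
Set Printing Implicit Defensive.

Theorem proposition2p10 (R : realType) (H : completeNormedModType R[i])
    (dot : {dot H for Num.conj}) (Hdot : hilbert_dot dot)
    (k n : nat) (k_gt0 : (0 < k)%N) (n_gt0 : (0 < n)%N)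
    (T S : {linear H -> H})
    (T_posinormal : quasi_power_posinormal dot k n T)
    (S_isometric : isometric_operator S)
    (TS_commute : T \o S =1 S \o T) :
  quasi_power_posinormal dot k n (T \o S).
Proof.
have [T_bounded T_range] := T_posinormal.
have S_bounded := isometric_bounded Hdot S_isometric.
split; first exact: bounded_comp.
set A := adjoint dot T in T_range; set B := adjoint dot S.
have BK : cancel S B by exact: adjoint_isometric.
(* The two sides are the adjoints of [S \o T] and [T \o S], which coincide. *)
have AB : A \o B =1 B \o A.
  by move=> y; rewrite -!(adjoint_comp Hdot)// (funext TS_commute).
have BA_iter m : iter m A \o iter k B =1 iter k B \o iter m A.
  by apply: iter_commute => y; rewrite -(iter_commute _ (fsym AB)).
have adjTS : adjoint dot (T \o S) = A \o B.
  by apply/funext => y; rewrite (adjoint_comp Hdot)// AB.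
move=> _ [x _ <-].
(* The range hypothesis is used at [iter n S x], because the [n]-th iterate of [T \o S] splits as
   [iter n T \o iter n S]. *)
have [|y _ Ay] := T_range (iter k A (iter n T (iter n S x))).
  by exists (iter n S x).
have iterS_AB : iter k.+1 (A \o B) (S y) = iter k B (iter k.+1 A y).
  rewrite (iter_comp_commute _ AB) [RHS](esym (BA_iter _ _)) /comp.
  (* The innermost of the [k.+1] copies of [B] cancels [S], leaving [k] of them. *)
  by rewrite [iter k.+1 B _]iterSr BK.
exists (S y) => //; rewrite adjTS iterS_AB Ay [LHS](esym (BA_iter _ _)).
rewrite /comp -[RHS](esym (iter_comp_commute _ AB _)).
by rewrite -[iter n (T \o S) x](esym (iter_comp_commute _ TS_commute _)).
Qed.
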